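(* Let $K\subseteq\mathbb{R}^d$ be a self-similar set, let $s=\dim_H(K)$ and let $l\in\mathbb{N}$ with $l\ge s$. Then either $K\subseteq M$ for some $l$-dimensional affine subspace $M$ of $\mathbb{R}^d$, or $\mathcal{H}^s(K\cap\Gamma)=0$ for every $l$-dimensional $C^1$ submanifold $\Gamma$ of $\mathbb{R}^d$.
   Context: A self-similar set in $\mathbb{R}^d$ is the attractor of a finite collection $\{S_i\}_{i=1}^m$ of contracting similarities of $\mathbb{R}^d$, i.e. the unique nonempty compact set $K$ with $K=\bigcup_{i=1}^m S_i(K)$ (no separation condition is assumed). $\dim_H$ is Hausdorff dimension and $\mathcal{H}^s$ is $s$-dimensional Hausdorff measure. *)

(* Defs.v *)
From HB Require Import structures.
From mathcomp Require Import all_boot all_order all_algebra.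
From mathcomp Require Import all_classical all_reals all_analysis.
Set Implicit Arguments.
Unset Strict Implicit.
Unset Printing Implicit Defensive.
Import Order.TTheory GRing.Theory Num.Theory.
Import numFieldNormedType.Exports.
Local Open Scope classical_set_scope.
Local Open Scope ring_scope.

(* R^d is ['rV[R]_d].  The library norm [`|x|] on row vectors is the sup norm:
   it induces the usual topology and the usual notion of differentiability, but
   similarities and Hausdorff measures must use the Euclidean distance. *)
Definition edist (R : realType) (d : nat) (x y : 'rV[R]_d) : R :=
  Num.sqrt (\sum_(i < d) (x 0 i - y 0 i) ^+ 2).

Definition contracting_similarity (R : realType) (d : nat)
    (S : 'rV[R]_d -> 'rV[R]_d) : Prop :=
  exists r : R, 0 < r < 1 /\ forall x y, edist (S x) (S y) = r * edist x y.

Definition is_attractor (R : realType) (d m : nat)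
    (S : 'I_m -> 'rV[R]_d -> 'rV[R]_d) (K : set 'rV[R]_d) : Prop :=
  [/\ K !=set0, compact K & K = \bigcup_(i in [set: 'I_m]) (S i @` K)].

Definition self_similar (R : realType) (d : nat) (K : set 'rV[R]_d) : Prop :=
  exists (m : nat) (S : 'I_m -> 'rV[R]_d -> 'rV[R]_d),
    (forall i, contracting_similarity (S i)) /\ is_attractor S K.

(* [-oo] on the empty set *)
Definition diam (R : realType) (d : nat) (U : set 'rV[R]_d) : \bar R :=
  ereal_sup [set (edist x y)%:E | x in U & y in U].

(* [diam(U)^s], with the convention that the empty set contributes 0 even when
   [s = 0]; since [poweR 0 0 = 1], H^0 is then the counting measure. *)
Definition diam_pow (R : realType) (d : nat) (s : R) (U : set 'rV[R]_d) :
    \bar R :=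
  if U == set0 then 0%E else poweR (diam U) s.

Definition hausdorff_content (R : realType) (d : nat) (s delta : R)
    (E : set 'rV[R]_d) : \bar R :=
  ereal_inf [set (\sum_(0 <= i <oo) diam_pow s (U i))%E |
    U in [set U : (set 'rV[R]_d)^nat |
      E `<=` \bigcup_i U i /\ forall i, (diam (U i) <= delta%:E)%E]].

(* The supremum is the limit as [delta] tends to 0 from above, because
   [hausdorff_content] is nonincreasing in [delta]. *)
Definition hausdorff_measure (R : realType) (d : nat) (s : R)
    (E : set 'rV[R]_d) : \bar R :=
  ereal_sup [set hausdorff_content s delta E | delta in [set delta : R | 0 < delta]].

Definition hausdorff_dim (R : realType) (d : nat) (E : set 'rV[R]_d) : \bar R :=
  ereal_inf [set s%:E | s in [set s : R | 0 <= s /\ hausdorff_measure s E = 0%E]].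

Definition affine_subspace (R : realType) (d l : nat) (M : set 'rV[R]_d) : Prop :=
  exists (a : 'rV[R]_d) (V : {vspace 'rV[R]_d}),
    \dim V = l /\ M = [set x | x - a \in V].

(* [U] is meant to be open. *)
Definition C1_on (R : realType) (n m : nat) (U : set 'rV[R]_n)
    (f : 'rV[R]_n -> 'rV[R]_m) : Prop :=
  forall x, U x -> differentiable f x /\ {for x, continuous (jacobian f)}.

Definition C1_diffeo (R : realType) (d : nat) (U V : set 'rV[R]_d)
    (f : 'rV[R]_d -> 'rV[R]_d) : Prop :=
  [/\ open U, open V, set_bij U V f, C1_on U f &
    exists g : 'rV[R]_d -> 'rV[R]_d, {in U, cancel f g} /\ C1_on V g].

(* R^l x {0} as a subset of R^d, for [l <= d] *)
Definition coord_plane (R : realType) (d l : nat) : set 'rV[R]_d :=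
  [set y | forall i : 'I_d, (l <= i)%N -> y 0 i = 0].

(* Embedded submanifolds without boundary, not necessarily closed in R^d. *)
Definition C1_submanifold (R : realType) (d l : nat) (G : set 'rV[R]_d) : Prop :=
  (l <= d)%N /\
  forall p, G p ->
    exists (U V : set 'rV[R]_d) (f : 'rV[R]_d -> 'rV[R]_d),
      [/\ U p, C1_diffeo U V f &
          f @` (U `&` G) = V `&` @coord_plane R d l].

(* Main.v *)
(* Let [s] be the dimension of [K].  If finitely many copies [S_w K] are pairwise
   disjoint then the sum of their ratios to the power [s] is at most 1:
   otherwise, for some [u >= s] with [H^u K = 0], the sum of the ratios to the
   power [u] would still be at least 1, and the classical covering argument for
   separated self-similar sets would give [H^u K > 0].

   If [K] lies in no [l]-plane, it contains [l + 2] affinely independent points.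
   At a small scale the submanifold is nearly flat, so every small copy [S_w K]
   meeting it has a subcopy, of relative ratio bounded below, at a positive
   distance from it.  Let [E] be a part of [K `&` Gamma] on which "small" is
   uniform.  At a given scale, a maximal disjoint family of copies meeting [E]
   covers [E] after enlargement, so the subcopies avoiding [E] have ratios whose
   powers [s] sum to at least a constant times the [delta]-content of [E].
   Repeating this at finer and finer scales produces arbitrarily many such
   families, all disjoint from each other, so the bound by 1 forces the content
   of [E] to vanish. *)
Require Import Defs.
From HB Require Import structures.
From mathcomp Require Import all_boot all_order all_algebra.
From mathcomp Require Import all_classical all_reals all_analysis.
From mathcomp Require Import ring lra.
Import Order.TTheory GRing.Theory Num.Theory.
Import numFieldNormedType.Exports.
Local Open Scope classical_set_scope.
Local Open Scope ring_scope.

(* mathcomp-analysis has its own, extended-real valued, [edist]. *)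
Local Notation edist := Defs.edist.

(** The least of finitely many thresholds serves all indices, since each [Q i] survives shrinking.
    Starting the minimum at 1 covers an empty [I]. *)
Lemma finite_pos_lbound {R : realType} (I : finType) (Q : I -> R -> Prop) :
  (forall i e e', 0 < e' <= e -> Q i e -> Q i e') ->
  (forall i, exists2 e : R, 0 < e & Q i e) ->
  exists2 e : R, 0 < e & forall i, Q i e.
Proof.
move=> Qmono Qex.
have [i|f fP] := @choice _ _ (fun i e => 0 < e /\ Q i e).
  by have [e e0 Qe] := Qex i; exists e.
exists (\big[Num.min/1]_i f i).
  by apply: lt_bigmin => // i _; have [] := fP i.
move=> i; apply: (Qmono i (f i)); last by have [] := fP i.
rewrite bigmin_le_cond// andbT.
by apply: lt_bigmin => // j _; have [] := fP j.
Qed.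

(** * Euclidean norm and distance, compared with the sup norm *)

Section euclidean_norm.
Context {R : realType} {d : nat}.
Implicit Types (x y z v : 'rV[R]_d) (a e : R).

Definition enorm v : R := Num.sqrt (\sum_(i < d) v 0 i ^+ 2).

Lemma edistE x y : edist x y = enorm (x - y).
Proof. by congr Num.sqrt; apply: eq_bigr => i _; rewrite !mxE. Qed.

Lemma enorm_sumsq_ge0 v : 0 <= \sum_(i < d) v 0 i ^+ 2.
Proof. by apply: sumr_ge0 => i _; exact: sqr_ge0. Qed.

Lemma sqr_enorm v : enorm v ^+ 2 = \sum_(i < d) v 0 i ^+ 2.
Proof. by rewrite sqr_sqrtr// enorm_sumsq_ge0. Qed.

Lemma enorm_ge0 v : 0 <= enorm v.
Proof. exact: sqrtr_ge0. Qed.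

Lemma enormZ a v : enorm (a *: v) = `|a| * enorm v.
Proof.
rewrite /enorm -sqrtr_sqr -sqrtrM ?sqr_ge0//; congr Num.sqrt.
by rewrite mulr_sumr; apply: eq_bigr => i _; rewrite mxE exprMn.
Qed.

Lemma enormN v : enorm (- v) = enorm v.
Proof. by rewrite -scaleN1r enormZ normrN1 mul1r. Qed.

Lemma enorm0 : enorm 0 = 0.
Proof. by rewrite -[0 in LHS](scale0r 0) enormZ normr0 mul0r. Qed.

Lemma enormD v w : enorm (v + w) <= enorm v + enorm w.
Proof.
set p := \sum_(i < d) v 0 i * w 0 i.
have expand t : \sum_(i < d) (v 0 i + t * w 0 i) ^+ 2 =
    enorm v ^+ 2 + 2 * t * p + t ^+ 2 * enorm w ^+ 2.
  rewrite !sqr_enorm /p !mulr_sumr -!big_split /=.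
  by apply: eq_bigr => i _; ring.
have n0 := enorm_ge0 v; have m0 := enorm_ge0 w.
have quad t : 0 <= enorm v ^+ 2 + 2 * t * p + t ^+ 2 * enorm w ^+ 2.
  by rewrite -expand; apply: sumr_ge0 => i _; exact: sqr_ge0.
have cs : p <= enorm v * enorm w.
  have [w0|w0] := eqVneq (enorm w) 0.
    rewrite w0 mulr0 leNgt; apply/negP => p0.
    (* With [enorm w = 0] the quadratic is affine in [t], and this [t] brings it to -1. *)
    have := quad (- (enorm v ^+ 2 + 1) / (2 * p)); rewrite w0.
    have -> : enorm v ^+ 2 + 2 * (- (enorm v ^+ 2 + 1) / (2 * p)) * p +
      (- (enorm v ^+ 2 + 1) / (2 * p)) ^+ 2 * 0 ^+ 2 = -1.
      by field; rewrite gt_eqF.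
    lra.
  have {}w0 : 0 < enorm w by rewrite lt_def w0.
  (* At this [t] the quadratic has the factor [enorm v * enorm w - p], whose sign is wanted; the
     other factor is positive unless [enorm v = 0]. *)
  have := quad (- (enorm v / enorm w)).
  have -> : enorm v ^+ 2 + 2 * - (enorm v / enorm w) * p +
    (- (enorm v / enorm w)) ^+ 2 * enorm w ^+ 2 =
    2 * enorm v / enorm w * (enorm v * enorm w - p).
    by field; rewrite gt_eqF.
  have [v0|v0] := eqVneq (enorm v) 0.
    move=> _; have /eqP : \sum_(i < d) v 0 i ^+ 2 = 0.
      by rewrite -sqr_enorm v0 expr0n.
    rewrite psumr_eq0 => [/allP vz|i _]; last exact: sqr_ge0.
    rewrite /p big1 ?v0 ?mul0r// => i _.
    have := vz i; rewrite mem_index_enum => /(_ isT).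
    by rewrite sqrf_eq0 => /eqP ->; rewrite mul0r.
  have {}v0 : 0 < enorm v by rewrite lt_def v0.
  by rewrite pmulr_rge0 ?subr_ge0// !mulr_gt0 ?invr_gt0.
rewrite -(@ler_pXn2r _ 2) ?nnegrE ?addr_ge0 ?enorm_ge0//.
rewrite sqr_enorm; under eq_bigr do rewrite mxE -[w 0 _]mul1r.
by rewrite expand; nra.
Qed.

Lemma coord_le_enorm v i : `|v 0 i| <= enorm v.
Proof.
rewrite -sqrtr_sqr; apply: ler_wsqrtr.
by rewrite (bigD1 i)//= lerDl sumr_ge0// => j _; exact: sqr_ge0.
Qed.

Lemma enorm_le v a : (forall i, `|v 0 i| <= a) -> enorm v <= d%:R * a.
Proof.
move=> va; have [d0|d0] := posnP d.
  by rewrite /enorm; subst d; rewrite big_ord0 sqrtr0 mul0r.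
have a0 : 0 <= a by exact: le_trans (va (Ordinal d0)).
rewrite -[leRHS]ger0_norm ?mulr_ge0// -sqrtr_sqr; apply: ler_wsqrtr.
apply: (@le_trans _ _ (\sum_(i < d) a ^+ 2)).
  apply: ler_sum => i _; rewrite -[leLHS]real_normK ?num_real//.
  by rewrite lerXn2r ?nnegrE.
rewrite sumr_const card_ord -[leLHS]mulr_natl exprMn ler_wpM2r ?sqr_ge0//.
by rewrite -natrX ler_nat -{1}(expn1 d) leq_pexp2l.
Qed.

Lemma coord_le_norm v i : `|v 0 i| <= `|v|.
Proof.
rewrite [leRHS]/Num.norm /= mx_normrE.
exact: (le_bigmax _ (fun ij => `|v ij.1 ij.2|) (0, i)).
Qed.

Lemma norm_le v a : 0 <= a -> (forall i, `|v 0 i| <= a) -> `|v| <= a.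
Proof.
move=> a0 va; rewrite [leLHS]/Num.norm /= mx_normrE.
by apply: bigmax_le => // -[i j] _; rewrite ord1.
Qed.

Lemma norm_le_enorm v : `|v| <= enorm v.
Proof. by apply: norm_le => [|i]; [exact: enorm_ge0|exact: coord_le_enorm]. Qed.

Lemma enorm_le_norm v : enorm v <= d%:R * `|v|.
Proof. by apply: enorm_le => i; exact: coord_le_norm. Qed.

Lemma edist_ge0 x y : 0 <= edist x y.
Proof. by rewrite edistE enorm_ge0. Qed.

Lemma edistxx x : edist x x = 0.
Proof. by rewrite edistE subrr enorm0. Qed.

Lemma edistC x y : edist x y = edist y x.
Proof. by rewrite !edistE -enormN opprB. Qed.

Lemma edist_triangle y x z : edist x z <= edist x y + edist y z.
Proof. by rewrite !edistE -[x - z](subrKA y) enormD. Qed.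

Lemma edist_gt0 x y : x != y -> 0 < edist x y.
Proof.
move=> xy; rewrite edistE (lt_le_trans _ (norm_le_enorm _))// normr_gt0.
by rewrite subr_eq0.
Qed.

Lemma nbhs_edist x e : 0 < e -> \forall y \near x, edist x y < e.
Proof.
(* [d.+1] instead of [d] avoids a zero denominator when [d = 0]. *)
move=> e0; have de0 : 0 < e / d.+1%:R by rewrite divr_gt0.
near=> y.
rewrite edistE (le_lt_trans (enorm_le_norm _))//.
rewrite (@le_lt_trans _ _ (d.+1%:R * `|x - y|))//.
  by rewrite ler_wpM2r// ler_nat.
by rewrite mulrC -ltr_pdivlMr//; near: y; exact: cvgr_dist_lt.
Unshelve. all: by end_near. Qed.

Lemma compact_edist_bounded (K : set 'rV[R]_d) : compact K ->
  exists2 D : R, 0 < D & forall x y, K x -> K y -> edist x y <= D.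
Proof.
move=> /compact_bounded /ex_strict_bound_gt0 [M M0 KM].
exists (d.+1%:R * (M + M)) => [|x y Kx Ky]; first by rewrite mulr_gt0 ?addr_gt0.
rewrite edistE (le_trans (enorm_le_norm _))// ler_pM ?ler_nat//.
rewrite (le_trans (ler_normB _ _))// lerD// ltW//; exact: KM.
Qed.

Lemma open_edist_nbhd (A : set 'rV[R]_d) e :
  open [set x | exists2 y, A y & edist y x < e].
Proof.
rewrite openE => x [y Ay yx]; rewrite /interior /=.
have := nbhs_edist x (e - edist y x); rewrite subr_gt0 => /(_ yx).
apply: filterS => z xz; exists y => //.
by rewrite (le_lt_trans (edist_triangle x _ _))// -ltrBrDl.
Qed.

(** The distance attains its minimum on the compact product, and a minimum of 0 would give a common
    point. *)
Lemma compact_edist_gap (K L : set 'rV[R]_d) : compact K -> compact L ->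
  K `&` L = set0 ->
  exists2 e : R, 0 < e & forall x y, K x -> L y -> e <= edist x y.
Proof.
move=> cK cL KL0.
have [KL|nKL] := pselect ((K `*` L) !=set0); last first.
  by exists 1 => // x y Kx Ly; exfalso; apply: nKL; exists (x, y).
pose f := fun xy : 'rV[R]_d * 'rV[R]_d => edist xy.1 xy.2.
have cf : continuous f.
  move=> -[x y]; apply/cvgrPdist_lt => e e0.
  have e20 : 0 < e / 2 by rewrite divr_gt0.
  have nx := nbhs_edist x _ e20; have ny := nbhs_edist y _ e20.
  exists ([set u | edist x u < e / 2], [set u | edist y u < e / 2]) => //.
  move=> -[u v] [/= xu yv]; rewrite /f /=.
  have t1 := edist_triangle u x y; have t2 := edist_triangle v u y.
  have t3 := edist_triangle x u v; have t4 := edist_triangle y x v.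
  rewrite (edistC v y) in t2; rewrite (edistC u x) in t3.
  by rewrite ltr_norml; apply/andP; split; lra.
have [|[x y] + fmin] := compact_EVT_min KL (compact_setX cK cL) (f := f).
  exact: continuous_subspaceT.
rewrite inE => -[/= Kx Ly]; exists (edist x y) => [|u v Ku Lv].
  apply: edist_gt0; apply/eqP => xy.
  have : (K `&` L) x by split => //; rewrite xy.
  by rewrite KL0.
by apply: (fmin (u, v)); rewrite inE.
Qed.

End euclidean_norm.

(** * Hausdorff contents and null sets *)

Section hausdorff.
Context {R : realType} {d : nat}.
Implicit Types (E U : set 'rV[R]_d) (s a e delta : R).

Lemma edist_le_diam U x y : U x -> U y -> ((edist x y)%:E <= diam U)%E.
Proof. by move=> Ux Uy; apply: ereal_sup_ubound; exists x => //; exists y. Qed.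

Lemma diam_le U a : (forall x y, U x -> U y -> edist x y <= a) ->
  (diam U <= a%:E)%E.
Proof.
move=> Ua; apply: ge_ereal_sup => _ [x Ux [y Uy <-]].
by rewrite lee_fin; exact: Ua.
Qed.

Lemma diam_ge0 U : U !=set0 -> (0 <= diam U)%E.
Proof.
by move=> [x Ux]; rewrite (le_trans _ (edist_le_diam _ _ _ Ux Ux))// edistxx.
Qed.

Lemma diam_pow_ge0 s U : (0 <= diam_pow s U)%E.
Proof. by rewrite /diam_pow; case: ifP => // _; exact: poweR_ge0. Qed.

Lemma diam_pow_le s U a : 0 <= s -> 0 <= a ->
  (forall x y, U x -> U y -> edist x y <= a) ->
  (diam_pow s U <= (a `^ s)%:E)%E.
Proof.
move=> s0 a0 Ua; rewrite /diam_pow; case: ifPn => [_|/set0P U0].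
  by rewrite lee_fin powR_ge0.
rewrite -poweR_EFin gt0_ler_poweR// ?in_itv/= ?leey ?lee_fin ?a0 ?diam_ge0//.
exact: diam_le.
Qed.

Lemma hausdorff_content_ge0 s delta E : (0 <= hausdorff_content s delta E)%E.
Proof.
apply: le_ereal_inf_tmp => _ [U _ <-].
by apply: nneseries_ge0 => i _ _; exact: diam_pow_ge0.
Qed.

Lemma hausdorff_measure_eq0 s E :
  hausdorff_measure s E = 0%E <->
  forall delta, 0 < delta -> hausdorff_content s delta E = 0%E.
Proof.
split=> [H0 delta d0|H0].
  apply/eqP; rewrite eq_le hausdorff_content_ge0 andbT -H0.
  by apply: ereal_sup_ubound; exists delta.
apply/eqP; rewrite eq_le; apply/andP; split.
  by apply: ge_ereal_sup => _ [delta d0 <-]; rewrite H0.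
rewrite -(H0 1)//; by apply: ereal_sup_ubound; exists 1 => //=; exact: ltr01.
Qed.

(** The finite family is padded to a sequence with empty sets, which contribute 0 even for [s = 0].
    The default [w0] is quantified because [T] may be empty. *)
Lemma hausdorff_content_finite_cover (T : Type) s delta E (W : seq T)
    (F : T -> set 'rV[R]_d) :
  (forall x, E x -> exists2 i, (i < size W)%N & forall w0, F (nth w0 W i) x) ->
  (forall w, (diam (F w) <= delta%:E)%E) ->
  (hausdorff_content s delta E <= \sum_(w <- W) diam_pow s (F w))%E.
Proof.
move=> EW Fd; case: W EW => [|w0 W'] EW.
  rewrite big_nil; apply: ereal_inf_lbound.
  exists (fun=> set0) => [|]; last first.
    by apply: eseries0 => i _ _; rewrite /diam_pow eqxx.
  split=> [x /EW[i]|i]; first by rewrite ltn0.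
  by apply: diam_le => ? ? [].
set W := w0 :: W' in EW *.
pose U i := if (i < size W)%N then F (nth w0 W i) else set0.
apply: ereal_inf_lbound; exists U => [|].
  split=> [x /EW[i iW /(_ w0) Fx]|i]; first by exists i => //; rewrite /U iW.
  rewrite /U; case: ifP => // _.
  by apply: diam_le => ? ? [].
rewrite (@nneseries_split _ _ 0 (size W)) => [|i _]; last exact: diam_pow_ge0.
rewrite add0n eseries0 ?adde0 => [|i Wi _].
  rewrite [RHS](big_nth w0); apply: eq_big_nat => i /andP[_ iW].
  by rewrite /U iW.
by rewrite /U ltnNge Wi /= /diam_pow eqxx.
Qed.

(** Covers of [E n] of cost at most [e / 2 ^ n.+1] are merged into one sequence along a bijection
    between [nat] and [nat * nat]. *)
Lemma hausdorff_content_le_bigcup s delta (E : (set 'rV[R]_d)^nat) e : 0 < e ->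
  (forall n, hausdorff_content s delta (E n) = 0%E) ->
  (hausdorff_content s delta (\bigcup_n E n) <= e%:E)%E.
Proof.
move=> e0 E0.
have en0 n : 0 < e / (2 ^ n.+1)%:R by rewrite divr_gt0// ltr0n expn_gt0.
have [G PG] : {G : nat -> (set 'rV[R]_d)^nat & forall n,
    [/\ E n `<=` \bigcup_i G n i, forall i, (diam (G n i) <= delta%:E)%E &
    (\sum_(0 <= i <oo) diam_pow s (G n i) <= (e / (2 ^ n.+1)%:R)%:E)%E]}.
  apply: (@choice _ _ (fun n (G : (set 'rV[R]_d)^nat) =>
    [/\ E n `<=` \bigcup_i G i, forall i, (diam (G i) <= delta%:E)%E &
    (\sum_(0 <= i <oo) diam_pow s (G i) <= (e / (2 ^ n.+1)%:R)%:E)%E])) => n.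
  have : (hausdorff_content s delta (E n) < (e / (2 ^ n.+1)%:R)%:E)%E.
    by rewrite E0 lte_fin.
  by move=> /ereal_inf_lt[_ [U [EU Ud] <-] /ltW le]; exists U.
have /card_esym/ppcard_eqP[f] := card_nat2.
apply: (@le_trans _ _ (\sum_(0 <= k <oo) diam_pow s (G (f k).1 (f k).2))%E).
  apply: ereal_inf_lbound; exists (fun k => G (f k).1 (f k).2) => //.
  split=> [x [n _ Enx]|k]; last first.
    by case: (f k) => i j; have [_ Gd _] := PG i; exact: Gd.
  have [EG _ _] := PG n; have [i _ Gx] := EG _ Enx.
  by exists (f^-1%FUN (n, i)) => //=; rewrite invK ?inE.
rewrite nneseries_esumT => [|k]; last exact: diam_pow_ge0.
rewrite -(reindex_esum [set: nat] [set: nat * nat] f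
  (fun x => diam_pow s (G x.1 x.2))) ; last exact: 'bij_f.
rewrite (_ : [set: nat * nat] = [set: nat] `*`` (fun=> [set: nat])); last first.
  by apply/seteqP; split.
rewrite -(@esum_esum _ _ _ [set: nat] (fun=> [set: nat])
  (fun i j => diam_pow s (G i j))) => [|i j _ _]; last exact: diam_pow_ge0.
apply: le_trans (epsilon_trick0 xpredT (ltW e0)).
rewrite [leRHS]nneseries_esumT => [|n]; last by rewrite lee_fin ltW.
apply: le_esum => n _.
rewrite -nneseries_esumT => [|i]; last exact: diam_pow_ge0.
by have [] := PG n.
Qed.

Lemma hausdorff_measure_bigcup0 s (E : (set 'rV[R]_d)^nat) :
  (forall n, hausdorff_measure s (E n) = 0%E) ->
  hausdorff_measure s (\bigcup_n E n) = 0%E.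
Proof.
move=> E0; apply/hausdorff_measure_eq0 => delta d0.
apply/eqP; rewrite eq_le hausdorff_content_ge0 andbT.
apply/lee_addgt0Pr => e e0; rewrite add0e.
apply: hausdorff_content_le_bigcup => // n.
by move/hausdorff_measure_eq0 : (E0 n) => /(_ _ d0).
Qed.

End hausdorff.

(** * Norms of linear combinations and affine independence *)

Section linear_combinations.
Context {R : realType} {d : nat}.
Implicit Types (x y v : 'rV[R]_d).

Lemma enorm_sum (I : finType) (F : I -> 'rV[R]_d) :
  enorm (\sum_i F i) <= \sum_i enorm (F i).
Proof.
elim/big_ind2: _ => [|v a w b va wb|//]; first by rewrite enorm0.
by rewrite (le_trans (enormD _ _))// lerD.
Qed.

(* By polarization, the norm of a linear combination of differences depends on
   mutual distances only, so it scales under a similarity even though the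
   similarity is not known to be affine. *)
Lemma enorm_lincomb (I : finType) (v w : I -> 'rV[R]_d) (c : I -> R) (r : R) :
  0 <= r -> (forall i, enorm (v i) = r * enorm (w i)) ->
  (forall i j, enorm (v i - v j) = r * enorm (w i - w j)) ->
  enorm (\sum_i c i *: v i) = r * enorm (\sum_i c i *: w i).
Proof.
move=> r0 vw vvww.
pose dot x y := \sum_(k < d) x 0 k * y 0 k.
have dotE x y : dot x y = (enorm x ^+ 2 + enorm y ^+ 2 - enorm (x - y) ^+ 2) / 2.
  rewrite !sqr_enorm -big_split -sumrB mulr_suml /=.
  by apply: eq_bigr => k _; rewrite !mxE; field.
have dotvw i j : dot (v i) (v j) = r ^+ 2 * dot (w i) (w j).
  by rewrite !dotE !vw !vvww; ring.
have expand (u : I -> 'rV[R]_d) : enorm (\sum_i c i *: u i) ^+ 2 =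
    \sum_i \sum_j c i * c j * dot (u i) (u j).
  rewrite sqr_enorm /dot.
  under [RHS]eq_bigr => i _ do under eq_bigr => j _ do rewrite mulr_sumr.
  under [RHS]eq_bigr => i _ do rewrite exchange_big.
  rewrite exchange_big; apply: eq_bigr => k _ /=.
  rewrite summxE expr2 mulr_suml; apply: eq_bigr => i _.
  rewrite mulr_sumr; apply: eq_bigr => j _.
  by rewrite !mxE; ring.
apply/eqP; rewrite -(@eqrXn2 _ 2) ?mulr_ge0 ?enorm_ge0// exprMn !expand.
rewrite mulr_sumr; apply/eqP; apply: eq_bigr => i _.
by rewrite mulr_sumr; apply: eq_bigr => j _; rewrite dotvw; ring.
Qed.

(** Coordinates in the family [X] are linear functionals in finite dimension, hence bounded. *)
Lemma free_lincomb_lbound n (X : n.-tuple 'rV[R]_d) : free X ->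
  exists2 kappa : R, 0 < kappa & forall (c : 'I_n -> R) i,
    kappa * `|c i| <= enorm (\sum_j c j *: X`_j).
Proof.
move=> fX.
have [||k k0 Hk] := finite_pos_lbound 'I_n (fun i k => forall c : 'I_n -> R,
    k * `|c i| <= enorm (\sum_j c j *: X`_j)).
- move=> i e e' /andP[_ ee'] He c; apply: le_trans (He c).
  by rewrite ler_wpM2r.
(* The values on the standard basis bound the functional; adding 1 makes the bound invertible. *)
- move=> i; pose C := \sum_(k < d) `|coord X i (delta_mx 0 k)|.
  have C1 : 0 < C + 1 by rewrite ltr_wpDl// sumr_ge0.
  exists (C + 1)^-1 => [|c]; first by rewrite invr_gt0.
  rewrite mulrC ler_pdivrMr//; set y := \sum_j _.
  have -> : c i = coord X i y by rewrite coord_sum_free.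
  rewrite [y in coord X i y]row_sum_delta linear_sum.
  rewrite (le_trans (ler_norm_sum _ _ _))// mulrDr mulr1.
  rewrite ler_wpDr ?enorm_ge0// mulr_sumr; apply: ler_sum => k _.
  by rewrite linearZ normrM ler_wpM2r// coord_le_enorm.
- by exists k => // c i; exact: Hk.
Qed.

Lemma free_extend l (X : seq 'rV[R]_d) : free X -> (size X <= l <= d)%N ->
  exists Y : seq 'rV[R]_d, [/\ free Y, size Y = l & {subset X <= Y}].
Proof.
move=> fX; elim: l => [|l IH].
  by rewrite leqn0 => /andP[/eqP /size0nil ->]; exists [::]; split => //; exact: nil_free.
move=> /andP[]; rewrite leq_eqVlt => /predU1P[Xl _|Xl ld]; first by exists X; split => // x.
have [|Y [fY Yl XY]] := IH; first by rewrite -ltnS Xl ltnW.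
have [v vY] : exists v, v \notin <<Y>>%VS.
  apply: contrapT => no.
  have : (fullv <= <<Y>>)%VS.
    apply/subvP => v _; apply/negPn/negP => vY; apply: no; by exists v.
  move/dimvS; rewrite dimvf /dim /= mul1n => /leq_trans/(_ (dim_span Y)).
  by rewrite Yl leqNgt ld.
exists (v :: Y); split; first by rewrite free_cons vY.
- by rewrite /= Yl.
- by move=> x /XY xY; rewrite inE xY orbT.
Qed.

(** Points are picked one at a time. The differences found so far, at most [l], are completed to [l]
    independent vectors because [affine_subspace] asks for dimension exactly [l]; then [K] has a
    point off the resulting plane through [p0]. *)
Lemma affinely_free_points (K : set 'rV[R]_d) l p0 : (l <= d)%N -> K p0 ->
  ~ (exists M : set 'rV[R]_d, affine_subspace l M /\ K `<=` M) ->
  exists X : l.+1.-tuple 'rV[R]_d, free X /\ forall i : 'I_l.+1, K (X`_i + p0).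
Proof.
move=> ld Kp0 noM.
suff H n : (n <= l.+1)%N -> exists X : seq 'rV[R]_d,
    [/\ free X, size X = n & forall x, x \in X -> K (x + p0)].
  have [X [fX /eqP sX KX]] := H l.+1 (leqnn _).
  exists (Tuple sX); split => // i; apply: KX.
  by rewrite mem_nth// (eqP sX).
elim: n => [_|n IH nl]; first by exists [::]; split => //; exact: nil_free.
have [X [fX sX KX]] := IH (ltnW nl).
have [Y [fY sY XY]] : exists Y : seq 'rV[R]_d,
    [/\ free Y, size Y = l & {subset X <= Y}].
  by apply: free_extend; rewrite // sX -ltnS nl.
have [p Kp pY] : exists2 p, K p & p - p0 \notin <<Y>>%VS.
  apply: contrapT => no; apply: noM.
  exists [set x | x - p0 \in <<Y>>%VS]; split.
    by exists p0, <<Y>>%VS; split => //; rewrite -sY; apply/eqP.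
  by move=> p Kp; apply/negPn/negP => pY; apply: no; exists p.
exists (p - p0 :: X); split.
- rewrite free_cons fX andbT; apply: contra pY.
  by apply/subvP; exact: sub_span.
- by rewrite /= sX.
- by move=> x; rewrite inE => /predU1P[->|/KX//]; rewrite subrK.
Qed.

(* Modulo the last [d - l] columns of [A], any [l + 1] vectors are dependent. *)
Lemma flat_lincomb l (A X : 'M[R]_d) : (l <= d)%N -> A *m X = 1%:M ->
  exists2 C : R, 0 < C & forall (z : 'I_l.+1 -> 'rV[R]_d) (t : R), 0 <= t ->
  (forall i (j : 'I_d), (l <= j)%N -> `|(z i *m A) 0 j| <= t) ->
  exists c : 'I_l.+1 -> R, [/\ forall i, `|c i| <= 1, exists i, `|c i| = 1 &
    enorm (\sum_i c i *: z i) <= C * t].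
Proof.
move=> ld AX; pose B := \sum_(k < d) \sum_(j < d) `|X j k|.
have B0 : 0 <= B by apply: sumr_ge0 => k _; apply: sumr_ge0.
exists (d%:R * (l.+1%:R * B) + 1) => [|z t t0 zt].
  by rewrite ltr_wpDl ?mulr_ge0.
pose Y := \matrix_(i < l.+1, j < l) (z i *m A) 0 (widen_ord ld j).
(* [Y] has [l.+1] rows but only [l] columns. *)
have : kermx Y != 0.
  rewrite kermx_eq0 /row_free neq_ltn; apply/orP; left.
  by rewrite ltnS rank_leq_col.
move=> /rowV0Pn[b /sub_kermxP bY b0].
(* Dividing by an entry of largest modulus bounds all coefficients by 1, with equality at [i0]. *)
have [i0 _ bi0] : exists2 i0, true & forall i, `|b 0 i| <= `|b 0 i0|.
  have [i0 _ /= bi0] := @arg_maxP _ _ _ (ord0 : 'I_l.+1) xpredT (fun i => `|b 0 i|) isT.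
  by exists i0 => // i; exact: bi0.
have bi00 : 0 < `|b 0 i0|.
  rewrite lt_def normr_ge0 andbT; apply: contra b0 => /eqP b0.
  apply/eqP/rowP => i; rewrite mxE; apply/eqP; rewrite -normr_le0 -b0; exact: bi0.
pose c i := b 0 i / b 0 i0.
have c1 i : `|c i| <= 1 by rewrite normrM normfV ler_pdivrMr// mul1r.
exists c; split => //.
  by exists i0; rewrite /c mulfV ?normr1// -normr_gt0.
pose y := (\sum_i c i *: z i) *m A.
have yE j : y 0 j = \sum_i c i * (z i *m A) 0 j.
  rewrite /y mulmx_suml summxE; apply: eq_bigr => i _.
  by rewrite -scalemxAl mxE.
(* The coordinates from [l] on are small by hypothesis; the first [l] vanish because [b] is in the
   kernel of [Y]. *)
have yj j : `|y 0 j| <= l.+1%:R * t.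
  have [lj|jl] := leqP l j.
    rewrite yE (le_trans (ler_norm_sum _ _ _))//.
    rewrite -[l.+1 in leRHS]card_ord -sumr_const mulr_suml; apply: ler_sum => i _.
    by rewrite normrM ler_pM ?zt.
  rewrite yE (_ : \sum_i _ = 0) ?normr0 ?mulr_ge0//.
  have bYj : \sum_i b 0 i * Y i (Ordinal jl) = 0.
    by have /rowP/(_ (Ordinal jl)) := bY; rewrite mxE [RHS]mxE.
  apply: (@eq_trans _ _ ((\sum_i b 0 i * Y i (Ordinal jl)) / b 0 i0)).
    rewrite mulr_suml; apply: eq_bigr => i _.
    rewrite /c [Y _ _]mxE mulrAC; congr (_ * (z i *m A) _ _ * _).
    exact: val_inj.
  by rewrite bYj mul0r.
have -> : \sum_i c i *: z i = y *m X by rewrite /y -mulmxA AX mulmx1.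
rewrite (@le_trans _ _ (d%:R * (l.+1%:R * t * B)))//; last first.
  by have : 0 <= t by []; lra.
apply: enorm_le => k; rewrite mxE (le_trans (ler_norm_sum _ _ _))//.
apply: (@le_trans _ _ (l.+1%:R * t * \sum_j `|X j k|)).
  rewrite mulr_sumr; apply: ler_sum => j _.
  by rewrite normrM ler_wpM2r.
rewrite ler_wpM2l ?mulr_ge0// /B [leRHS](bigD1 k)//= lerDl.
by apply: sumr_ge0 => k' _; apply: sumr_ge0.
Qed.

End linear_combinations.

(** * Flatness of a submanifold near a point *)

Section tangent.
Context {R : realType} {d : nat}.

Lemma open_near0 (U : set 'rV[R]_d) x : open U -> U x ->
  \forall h \near (0 : 'rV[R]_d), U (h + x).
Proof.
move=> oU Ux; have /nbhs_normP[e /= e0 He] : nbhs x U by exact: open_nbhs_nbhs.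
apply/nbhs_normP; exists e => // h /=; rewrite /ball_ /= sub0r normrN => he.
by apply: He; rewrite /ball_ /= opprD addrCA subrr addr0 normrN.
Qed.

(** Chain rule for [g \o f], which agrees with the identity on the open set [U] around [x]. *)
Lemma diff_local_inverse (U : set 'rV[R]_d) (f g : 'rV[R]_d -> 'rV[R]_d) x v :
  open U -> U x -> {in U, cancel f g} -> differentiable f x ->
  differentiable g (f x) -> 'd g (f x) ('d f x v) = v.
Proof.
move=> oU Ux fK df dg.
have dgf : 'd (g \o f) x = idfun :> ('rV[R]_d -> 'rV[R]_d).
  apply: (@diff_unique _ _ _ (g \o f) idfun x).
    by move=> y; exact: cvg_id.
  apply/eqaddoP => e e0.
  have := open_near0 _ _ oU Ux; apply: filterS => h Uh.
  rewrite [X in `|X|](_ : _ = 0) ?normr0 ?mulr_ge0 ?(ltW e0)//.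
  transitivity (g (f (h + x)) - (g (f x) + h)); first by [].
  by rewrite !fK ?inE// [h + x]addrC subrr.
have comp := @diff_comp _ _ _ _ f g x df dg.
have e : ('d g (f x) \o 'd f x) = idfun :> ('rV[R]_d -> 'rV[R]_d).
  exact: etrans (esym comp) dgf.
exact: (congr1 (fun F : 'rV[R]_d -> 'rV[R]_d => F v) e).
Qed.

(* [A] is the Jacobian of a chart, which flattens [G] onto the first [l]
   coordinates. *)
Lemma C1_submanifold_tangent l (G : set 'rV[R]_d) x :
  C1_submanifold l G -> G x ->
  exists A X : 'M[R]_d, A *m X = 1%:M /\
  forall eta : R, 0 < eta -> exists2 theta : R, 0 < theta &
  forall q (j : 'I_d), G q -> `|q - x| < theta -> (l <= j)%N ->
    `|((q - x) *m A) 0 j| <= eta * `|q - x|.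
Proof.
move=> [_ /(_ x) chart] /[dup] Gx /chart {chart}.
move=> [U [V [f [Ux [oU oV bijf C1f [g [fK C1g]]] fUG]]]].
have Vfx : V (f x) by have [] := bijf => + _ _; apply.
have [df _] := C1f _ Ux; have [dg _] := C1g _ Vfx.
exists (jacobian f x), (jacobian g (f x)); split.
  (* Row vectors are multiplied on the right, so [A *m X] is the differential of [f] followed by
     that of [g]. *)
  apply/row_matrixP => i; rewrite !rowE mulmxA !mul_rV_lin1 mulmx1.
  exact: diff_local_inverse oU Ux fK df dg.
move=> eta eta0.
have [_ /eqaddoP/(_ eta eta0)] := (diff_locallyP _ _).1 df.
move=> nf.
have /nbhs_normP[t1 /= t10 Ht1] := open_near0 _ _ oU Ux.
have /nbhs_normP[t2 /= t20 Ht2] := nf.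
exists (Num.min t1 t2) => [|q j Gq]; first by rewrite lt_min t10.
rewrite lt_min => /andP[qx1 qx2] lj.
have Uq : U q by rewrite -(subrK x q); apply: Ht1; rewrite /ball_ /= sub0r normrN.
apply: le_trans (Ht2 (q - x) _); last by rewrite /ball_ /= sub0r normrN.
have coord0 y : U y -> G y -> f y 0 j = 0.
  move=> Uy Gy; have : (f @` (U `&` G)) (f y) by exists y.
  by rewrite fUG => -[_]; exact.
(* Both [f q] and [f x] have coordinate [j] equal to 0, so the linear part is minus the remainder
   there. *)
have -> : ((q - x) *m jacobian f x) 0 j =
    - (f \o shift x - (cst (f x) + 'd f x)) (q - x) 0 j.
  rewrite mul_rV_lin1 !fctE /= /shift subrK !mxE (coord0 q)// (coord0 x)//.
  by rewrite !add0r opprK.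
by rewrite normrN coord_le_norm.
Qed.

End tangent.

(** * Positive Hausdorff measure from separated copies *)

Section separated_copies.
Context {R : realType} {d : nat}.
Implicit Types (K : set 'rV[R]_d) (u g q : R).

(* A cover of [K] whose members are shorter than the gap [g] splits into
   disjoint subfamilies, one for each copy [T j @` K]; pulling these back by
   [T j] gives covers of [K] with larger members, whence the induction. *)
Lemma cover_powR_sum_ge K n (T : 'I_n -> 'rV[R]_d -> 'rV[R]_d) (r : 'I_n -> R)
    g q u :
  K !=set0 -> 0 <= u -> 0 < g -> 0 < q ->
  (forall j, 0 < r j <= q) ->
  (forall j x y, edist (T j x) (T j y) = r j * edist x y) ->
  (forall j x, K x -> K (T j x)) ->
  (forall j j' x y, j != j' -> K x -> K y -> g <= edist (T j x) (T j' y)) ->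
  1 <= \sum_j r j `^ u ->
  forall k (I : finType) (P : pred I) (U : I -> set 'rV[R]_d) (a : I -> R),
  (forall x, K x -> exists2 i, P i & U i x) ->
  (forall i x y, P i -> U i x -> U i y -> edist x y <= a i) ->
  (forall i, P i -> g * q ^+ k <= a i) ->
  g `^ u <= \sum_(i | P i) a i `^ u.
Proof.
move=> [x0 Kx0] u0 g0 q0 rq rT TK gap sum1 + I.
(* A single member with bound at least [g] suffices; this settles [k = 0], where every member is of
   this kind. *)
have one (P : pred I) (a : I -> R) i : P i -> g <= a i ->
    g `^ u <= \sum_(i | P i) a i `^ u.
  move=> Pi gai; rewrite (bigD1 i)//=.
  apply: (@le_trans _ _ (a i `^ u)).
    by apply: ge0_ler_powR; rewrite ?nnegrE// ?ltW// (lt_le_trans g0).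
  by rewrite lerDl sumr_ge0// => j _; exact: powR_ge0.
elim=> [|k IH] P U a KU Ua ga.
  have [i Pi _] := KU _ Kx0.
  by apply: (one _ _ i) => //; have := ga i Pi; rewrite expr0 mulr1.
have [[i /andP[Pi gai]]|no] := pselect (exists i, P i && (g <= a i)).
  exact: (one _ _ i).
have ltg i : P i -> a i < g.
  by move=> Pi; rewrite ltNge; apply/negP => gai; apply: no; exists i; rewrite Pi.
pose M j i : bool := `[< exists2 x, K x & U i (T j x) >].
have a_ge0 i : P i -> 0 <= a i.
  by move=> Pi; rewrite (le_trans _ (ga i Pi))// mulr_ge0 ?exprn_ge0 ?ltW.
(* Pulling back by [T j] divides sizes by [r j <= q], so the lower bound [g * q ^+ k.+1] becomes
   [g * q ^+ k]. *)
have each j : r j `^ u * g `^ u <= \sum_(i | P i && M j i) a i `^ u.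
  have /andP[rj0 rjq] := rq j.
  have := IH (fun i => P i && M j i) (fun i => [set x | U i (T j x)])
    (fun i => a i / r j).
  have -> : \sum_(i | P i && M j i) (a i / r j) `^ u =
      (\sum_(i | P i && M j i) a i `^ u) / r j `^ u.
    rewrite mulr_suml; apply: eq_bigr => i /andP[Pi _].
    by rewrite powRM ?invr_ge0 ?a_ge0 ?(ltW rj0)// -powR_inv1 ?(ltW rj0)//
      -powRrM mulN1r powRN.
  rewrite ler_pdivlMr ?powR_gt0// [g `^ u * _]mulrC; apply.
  - move=> x Kx; have [i Pi Ui] := KU _ (TK j _ Kx); exists i => //.
    by rewrite Pi; apply/asboolP; exists x.
  - move=> i x y /andP[Pi _] /= Ux Uy.
    by rewrite ler_pdivlMr// mulrC -rT; exact: Ua.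
  - move=> i /andP[Pi _]; rewrite ler_pdivlMr//.
    rewrite (le_trans _ (ga i Pi))// exprSr mulrA ler_wpM2l//.
    by rewrite mulr_ge0 ?exprn_ge0 ?ltW.
apply: (@le_trans _ _ (\sum_j r j `^ u * g `^ u)).
  by rewrite -mulr_suml ler_peMl ?powR_ge0.
apply: (le_trans (ler_sum _ (fun j _ => each j))).
rewrite (exchange_big_dep P) => [|j i _ /andP[]//].
(* All members are now shorter than the gap, so each meets at most one copy and is counted at most
   once. *)
apply: ler_sum => i Pi; rewrite (eq_bigl (M^~ i)) => [|j]; last by rewrite Pi.
have [[j Mji]|noj] := pselect (exists j, M j i); last first.
  rewrite big_pred0 ?powR_ge0// => j; apply/negP => Mji; apply: noj.
  by exists j.
rewrite (big_pred1 j)// => j' /=; apply/idP/eqP => [Mj'i|->//].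
apply/eqP; apply/negPn/negP => jj'; move/asboolP : Mji => [x Kx Ux].
move/asboolP : Mj'i => [y Ky Uy].
have := gap _ _ _ _ jj' Ky Kx; rewrite leNgt => /negP; apply.
by apply: le_lt_trans (ltg i Pi); apply: Ua.
Qed.

(** Used to replace the members of a cover by open sets at small extra cost. The case [u = 0] is
    apart, as the power is then constantly 1. *)
Lemma powR_enlarge u (t e : R) : 0 <= u -> 0 <= t -> 0 < e ->
  exists2 b : R, t < b & b `^ u <= t `^ u + e.
Proof.
rewrite le_eqVlt => /predU1P[<-|u0] t0 e0.
  by exists (t + 1); rewrite ?ltrDl// !powRr0 lerDl ltW.
exists ((t `^ u + e) `^ u^-1); last first.
  by rewrite -powRrM mulVf ?gt_eqF// powRr1// addr_ge0 ?powR_ge0 ?ltW.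
rewrite -[ltLHS](@powRr1 _ t)// -[X in t `^ X](@mulfV _ u) ?gt_eqF//.
rewrite powRrM gt0_ltr_powR ?invr_gt0 ?nnegrE ?powR_ge0//.
  by rewrite addr_ge0 ?powR_ge0 ?ltW.
by rewrite ltrDl.
Qed.

(** Measure zero would give a cheap cover of [K]. Made open and then finite by compactness, it would
    violate the lower bound on power sums set by the gap between the copies. *)
Lemma hausdorff_measure_neq0 K n (T : 'I_n -> 'rV[R]_d -> 'rV[R]_d)
    (r : 'I_n -> R) u :
  K !=set0 -> compact K -> 0 <= u ->
  (forall j, 0 < r j < 1) ->
  (forall j x y, edist (T j x) (T j y) = r j * edist x y) ->
  (forall j x, K x -> K (T j x)) ->
  (forall j j' x y, j != j' -> K x -> K y -> T j x <> T j' y) ->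
  1 <= \sum_j r j `^ u ->
  hausdorff_measure u K <> 0%E.
Proof.
move=> K0 cK u0 r01 rT TK TT sum1 HK.
have cT j : continuous (T j).
  move=> x; apply/(@cvgrPdist_lt _ _ _ _ (nbhs_filter x)) => e e0.
  have /andP[rj0 rj1] := r01 j.
  have := nbhs_edist x e e0; apply: filterS => y; apply: le_lt_trans.
  rewrite (le_trans (norm_le_enorm _))// -edistE rT.
  by rewrite ler_piMl ?edist_ge0 ?ltW.
have cTK j : compact (T j @` K).
  by apply: continuous_compact => //; exact: continuous_subspaceT.
have [g g0 gap] : exists2 g : R, 0 < g & forall jj : 'I_n * 'I_n, jj.1 != jj.2 ->
    forall x y, K x -> K y -> g <= edist (T jj.1 x) (T jj.2 y).
  apply: finite_pos_lbound => [jj e e' /andP[_ ee'] He jj' x y Kx Ky|[j j']].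
    by rewrite (le_trans ee')// He.
  have [jj'|jj'] := eqVneq j j'; first by exists 1 => //=; rewrite jj' eqxx.
  have [|e e0 He] := compact_edist_gap _ _ (cTK j) (cTK j').
    apply/seteqP; split=> // _ [[x Kx <-] [y Ky]] /esym yx.
    exact: (TT _ _ _ _ jj' Kx Ky).
  by exists e => // _ x y Kx Ky; apply: He; [exists x|exists y].
have [q q01 rq] : exists2 q : R, 0 < q < 1 & forall j, 0 < r j <= q.
  have [e e0 He] : exists2 e : R, 0 < e & forall j, r j <= 1 - e.
    apply: finite_pos_lbound => [j e e' /andP[_ ee'] /le_trans|j]; first by apply; rewrite lerB.
    by exists (1 - r j); [have /andP[] := r01 j; lra|lra].
  exists (Num.max (1 - e) 2^-1); last first.
    by move=> j; rewrite le_max He; have /andP[->] := r01 j.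
  by rewrite lt_max gt_max; apply/andP; split; [apply/orP; right|]; lra.
have /andP[q0 q1] := q01.
have gu : 0 < g `^ u by rewrite powR_gt0.
have e0 : 0 < g `^ u / 4 by rewrite divr_gt0.
have /ereal_inf_lt[_ [U [KU U1] <-] Usum] :
    (hausdorff_content u 1 K < (g `^ u / 4)%:E)%E.
  by move/hausdorff_measure_eq0 : HK => ->; rewrite ?lte_fin.
have dfin i : U i !=set0 -> diam (U i) \is a fin_num.
  move=> Ui; rewrite ge0_fin_numE ?diam_ge0//.
  by rewrite (le_lt_trans (U1 i))// ltey.
(* The budget for enlarging member [i]; the budgets add up to a quarter of the lower bound. *)
pose b i := g `^ u / 4 / (2 ^ i.+1)%:R.
have b0 i : 0 < b i by rewrite divr_gt0// ltr0n expn_gt0.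
have [a aP] : {a : nat -> R & forall i, U i !=set0 ->
    fine (diam (U i)) < a i /\ ((a i `^ u)%:E <= diam_pow u (U i) + (b i)%:E)%E}.
  apply: (@choice _ _ (fun i a => U i !=set0 ->
    fine (diam (U i)) < a /\ ((a `^ u)%:E <= diam_pow u (U i) + (b i)%:E)%E)) => i.
  have [Ui|] := pselect (U i !=set0); last by exists 0.
  have [|a ta au] := powR_enlarge _ (fine (diam (U i))) _ u0 _ (b0 i).
    by rewrite fine_ge0 ?diam_ge0.
  exists a => _; split => //; rewrite /diam_pow ifN; last exact/set0P.
  by rewrite -(fineK (dfin _ Ui)) poweR_EFin -EFinD lee_fin.
(* The radius is half the slack between [a i] and the diameter, so pairs of points of [V i] stay
   within [a i]. *)
pose V i := [set x | exists2 y, U i y & edist y x < (a i - fine (diam (U i))) / 2].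
have Va i x y : V i x -> V i y -> edist x y <= a i.
  move=> [x' Ux' xx'] [y' Uy' yy']; have Ui : U i !=set0 by exists x'.
  have : edist x' y' <= fine (diam (U i)).
    by rewrite -lee_fin fineK ?dfin// edist_le_diam.
  have := edist_triangle x' x y; have := edist_triangle y' x' y.
  rewrite (edistC x x'); lra.
have : cover_compact K by rewrite -compact_cover.
move=> /(_ nat setT V (fun i _ => open_edist_nbhd _ _)) [|D _ KD].
  move=> x /KU [i _ Ux]; exists i => //; exists x => //.
  have [|ai _] := aP i; first by exists x.
  by rewrite edistxx divr_gt0// subr_gt0.
(* [P] discards the empty members, for which [a i] is arbitrary. *)
pose I := 'I_(\max_(i <- finmap.enum_fset D) i).+1; pose P (i : I) : bool := `[< U i !=set0 >].
have KV x : K x -> exists2 i : I, P i & V i x.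
  move=> /KD [i /= Di Vx].
  have iI : (i < (\max_(i <- finmap.enum_fset D) i).+1)%N by rewrite ltnS (leq_bigmax_seq _ Di).
  exists (Ordinal iI) => //; apply/asboolP.
  by have [y Uy _] := Vx; exists y.
have [k ak] : exists k, forall i : I, P i -> g * q ^+ k <= a i.
  have [e e1 He] : exists2 e : R, 0 < e & forall i : I, P i -> e <= a i.
    apply: finite_pos_lbound => [i e e' /andP[_ ee'] He Pi|i].
      by rewrite (le_trans ee')// He.
    have [/asboolP Ui|nPi] := boolP (P i); last by exists 1.
    exists (a i) => //; have [+ _] := aP _ Ui.
    by apply: le_lt_trans; rewrite fine_ge0 ?diam_ge0.
  have : (q ^+ n @[n --> \oo] --> (0 : R)) by apply: cvg_expr; rewrite ger0_norm ?ltW.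
  move=> /cvgrPdist_lt/(_ (e / g)) []; first by rewrite divr_gt0.
  move=> k _ /(_ k (leqnn k)); rewrite /= sub0r normrN ger0_norm ?exprn_ge0 ?ltW//.
  rewrite ltr_pdivlMr// mulrC => /ltW lt; exists k => i Pi.
  by rewrite (le_trans lt)// He.
have := cover_powR_sum_ge _ _ _ _ _ _ _ K0 u0 g0 q0 rq rT TK
  (fun j j' x y jj' => gap (j, j') jj' x y) sum1 k _ P (fun i => V i) (fun i => a i)
  KV (fun i x y _ => Va i x y) ak.
(* The cover costs less than a quarter of the lower bound, and its enlargement at most another
   quarter. *)
rewrite leNgt => /negP; apply; rewrite -lte_fin -sumEFin.
apply: (@le_lt_trans _ _ (\sum_(i < (\max_(i <- finmap.enum_fset D) i).+1)
    (diam_pow u (U i) + (b i)%:E))%E).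
  rewrite big_mkcond; apply: lee_sum => i _; case: ifPn => [/asboolP Ui|_].
    by have [] := aP _ Ui.
  by rewrite adde_ge0 ?diam_pow_ge0 ?lee_fin ?ltW.
apply: (@le_lt_trans _ _ (\sum_(0 <= i <oo) (diam_pow u (U i) + (b i)%:E))%E).
  rewrite -(big_mkord xpredT (fun i => diam_pow u (U i) + (b i)%:E)%E).
  by apply: nneseries_lim_ge => i _; rewrite adde_ge0 ?diam_pow_ge0 ?lee_fin ?ltW.
apply: (le_lt_trans (epsilon_trick xpredT _ (ltW e0))) => [i|].
  exact: diam_pow_ge0.
apply: (@lt_le_trans _ _ ((g `^ u / 4)%:E + (g `^ u / 4)%:E)%E).
  by rewrite lteD2rE.
by rewrite -EFinD lee_fin; lra.
Qed.

End separated_copies.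

(** * Words, disjoint copies, and sets avoided by subcopies at every small scale *)

Section porous_subsets.
Context {R : realType} {d m : nat}.
Context (S : 'I_m -> 'rV[R]_d -> 'rV[R]_d) (r : 'I_m -> R) (K : set 'rV[R]_d).
Context (r01 : forall i, 0 < r i < 1).
Context (rS : forall i x y, edist (S i x) (S i y) = r i * edist x y).
Context (K0 : K !=set0) (cK : compact K).
Context (KS : K = \bigcup_(i in [set: 'I_m]) (S i @` K)).
Implicit Types (w v : seq 'I_m) (E : set 'rV[R]_d).

Definition word_map w x : 'rV[R]_d := foldr S x w.

Definition word_ratio w : R := \prod_(i <- w) r i.

Lemma word_map_cat w v x : word_map (w ++ v) x = word_map w (word_map v x).
Proof. by rewrite /word_map foldr_cat. Qed.

Lemma word_ratio_cat w v : word_ratio (w ++ v) = word_ratio w * word_ratio v.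
Proof. by rewrite /word_ratio big_cat. Qed.

Lemma word_ratio_cons i w : word_ratio (i :: w) = r i * word_ratio w.
Proof. by rewrite /word_ratio big_cons. Qed.

Lemma word_ratio_gt0 w : 0 < word_ratio w.
Proof. by apply: prodr_gt0 => i _; have /andP[] := r01 i. Qed.

Lemma word_ratio_le1 w : word_ratio w <= 1.
Proof.
elim: w => [|i w IH]; first by rewrite /word_ratio big_nil.
rewrite word_ratio_cons; have := word_ratio_gt0 w.
have /andP[] := r01 i; nra.
Qed.

Lemma edist_word_map w x y :
  edist (word_map w x) (word_map w y) = word_ratio w * edist x y.
Proof.
elim: w => [|i w IH]; first by rewrite /word_ratio big_nil mul1r.
by rewrite /= rS IH word_ratio_cons mulrA.
Qed.

Lemma word_map_in w x : K x -> K (word_map w x).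
Proof.
by move=> Kx; elim: w => [//|i w IH] /=; rewrite KS; exists i => //; exists (word_map w x).
Qed.

Definition disjoint_words w v : bool :=
  `[< forall x y, K x -> K y -> word_map w x <> word_map v y >].

Lemma powR_sum_disjoint_words_le1 (s : R) (W : seq (seq 'I_m)) :
  hausdorff_dim K = s%:E -> pairwise disjoint_words W ->
  (forall w, w \in W -> word_ratio w < 1) ->
  \sum_(w <- W) word_ratio w `^ s <= 1.
Proof.
move=> dimK disW W1; rewrite big_tnth leNgt; apply/negP.
set A := (X in 1 < X) => A1.
pose t := tnth (in_tuple W); pose rt j := word_ratio (t j).
have rt01 j : 0 < rt j < 1 by rewrite word_ratio_gt0 W1 ?mem_tnth.
have [q q01 rq] : exists2 q : R, 0 < q < 1 & forall j, q <= rt j.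
  have [e e0 He] : exists2 e : R, 0 < e & forall j, e <= rt j.
    apply: finite_pos_lbound => [j e e' /andP[_ ee']|j]; first exact: le_trans.
    by exists (rt j); rewrite ?word_ratio_gt0.
  exists (Num.min e 2^-1); last by move=> j; rewrite ge_min He.
  by rewrite lt_min gt_min e0; apply/andP; split; [|apply/orP; right]; lra.
have /andP[q0 q1] := q01.
have lnq : ln q < 0 by rewrite ln_lt0.
(* Chosen so that [q] to the power [tau] is the inverse of [A]: raising the exponent by at most
   [tau] divides the sum by at most [A], which leaves it at least 1. *)
pose tau := ln A / - ln q.
have tau0 : 0 < tau by rewrite divr_gt0 ?ln_gt0// oppr_gt0.
have qtau : q `^ tau = A^-1.
  rewrite /powR gt_eqF// /tau -mulrA invrN mulNr mulVf ?lt_eqF// mulrN1.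
  by rewrite expRN lnK// posrE (lt_trans _ A1).
have : (hausdorff_dim K < (s + tau)%:E)%E by rewrite dimK lte_fin ltrDl.
move=> /ereal_inf_lt[_ [u [u0 HuK] <-]]; rewrite lte_fin => us.
have su : s <= u.
  by rewrite -lee_fin -dimK; apply: ereal_inf_lbound; exists u.
apply: (hausdorff_measure_neq0 K _ (fun j => word_map (t j)) rt u) => //.
- by move=> j x y; exact: edist_word_map.
- by move=> j x; exact: word_map_in.
- have dis i j x y : (i < j)%N -> (j < size W)%N -> K x -> K y ->
      word_map (nth [::] W i) x <> word_map (nth [::] W j) y.
    move=> ij jW Kx Ky; move/(pairwiseP [::]) : disW => /(_ i j).
    by move=> /(_ (ltn_trans ij jW) jW ij) /asboolP; exact.
  move=> j j' x y; rewrite neq_ltn /t !(tnth_nth [::]) => /orP[] jj' Kx Ky.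
    exact: dis.
  by apply/nesym; exact: dis.
- have A0 : 0 < A by exact: lt_trans A1.
  rewrite -(mulfV (lt0r_neq0 A0)) -qtau /A mulr_suml; apply: ler_sum => j _.
  have /andP[rj0 rj1] := rt01 j.
  rewrite -[leRHS](_ : rt j `^ s * rt j `^ (u - s) = _); last first.
    by rewrite -powRD ?subrKC ?(gt_eqF rj0) ?implybT// addrC subrK.
  rewrite ler_wpM2l ?powR_ge0//.
  apply: (@le_trans _ _ (q `^ (u - s))).
    by rewrite ger_powR ?q0 ?ltW//; lra.
  by apply: ge0_ler_powR; rewrite ?nnegrE ?subr_ge0// ltW.
Qed.

Lemma ratio_bounds : exists a b : R, [/\ 0 < a < 1, 0 < b < 1 & forall i, a <= r i <= b].
Proof.
have [e e0 He] : exists2 e : R, 0 < e & forall i, e <= r i <= 1 - e.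
  apply: finite_pos_lbound => [i e e' /andP[_ ee'] /andP[h1 h2]|i].
    by apply/andP; split; lra.
  have /andP[ri0 ri1] := r01 i.
  exists (Num.min (r i) (1 - r i)); first by rewrite lt_min ri0/=; lra.
  rewrite ge_min lexx /=.
  have : Num.min (r i) (1 - r i) <= 1 - r i by rewrite ge_min lexx orbT.
  lra.
exists (Num.min e 2^-1), (1 - Num.min e 2^-1).
have h1 : Num.min e 2^-1 <= e by rewrite ge_min lexx.
have h2 : Num.min e 2^-1 <= 2^-1 by rewrite ge_min lexx orbT.
have h3 : 0 < Num.min e 2^-1 by rewrite lt_min e0/=; lra.
split; [by apply/andP; split; lra|by apply/andP; split; lra|move=> i].
by have /andP[] := He i; move=> ? ?; apply/andP; split; lra.
Qed.

(* Stop the coding of [x] as soon as the ratio drops below [rho]. *)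
Lemma word_at_scale : exists2 a : R, 0 < a < 1 & forall (rho : R) x, 0 < rho <= 1 -> K x ->
  exists w, (a * rho <= word_ratio w <= rho) /\ (word_map w @` K) x.
Proof.
have [a [b [a01 /andP[b0 b1] ab]]] := ratio_bounds.
have /andP[a0 a1] := a01.
exists a => // rho x /andP[rho0 rho1] Kx.
(* Either some prefix has stopped, or the prefix of length [n] has ratio between [rho] and [b ^+ n],
   impossible for large [n]. The last letter multiplies the ratio by at least [a], whence
   [a * rho]. *)
have step n : (exists w, (a * rho <= word_ratio w <= rho) /\ (word_map w @` K) x) \/
    (exists w, [/\ rho < word_ratio w, word_ratio w <= b ^+ n & (word_map w @` K) x]).
  elim: n => [|n [IH|[w [rhow wb [y Ky yx]]]]]; [|by left|].
    move: rho1; rewrite le_eqVlt => /predU1P[->|rho1]; [left|right]; exists [::].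
      by rewrite /word_ratio big_nil mulr1 lexx (ltW a1); split => //; exists x.
    by rewrite /word_ratio big_nil; split => //; exists x.
  have [i _ [z Kz zy]] : (\bigcup_(i in [set: 'I_m]) (S i @` K)) y by rewrite -KS.
  have wiE : word_ratio (w ++ [:: i]) = word_ratio w * r i.
    by rewrite word_ratio_cat word_ratio_cons /word_ratio big_nil mulr1.
  have wix : (word_map (w ++ [:: i]) @` K) x.
    by exists z => //; rewrite word_map_cat /= zy.
  have /andP[ai ib] := ab i; have w0 := word_ratio_gt0 w.
  have [le|lt] := leP (word_ratio (w ++ [:: i])) rho; [left|right];
    exists (w ++ [:: i]).
    by split => //; rewrite le andbT wiE mulrC ler_pM// ltW.
  by split => //; rewrite exprSr wiE ler_pM// ltW// (lt_le_trans a0).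
have : b ^+ n @[n --> \oo] --> (0 : R) by apply: cvg_expr; rewrite ger0_norm ?ltW.
move=> /cvgrPdist_lt/(_ _ rho0)[n _ /(_ n (leqnn n))] /=.
rewrite sub0r normrN ger0_norm ?exprn_ge0 ?(ltW b0)// => bn.
have [//|[w [rhow wb _]]] := step n.
by move: (lt_trans rhow (le_lt_trans wb bn)); rewrite ltxx.
Qed.

(** A positive distance, not mere disjointness: it keeps every sufficiently small copy that meets
    [E] off this one. *)
Definition word_away E w : Prop :=
  exists2 e : R, 0 < e & forall x y, K x -> E y -> e <= edist (word_map w x) y.

Lemma hausdorff_dim_ge0 E (s : R) : hausdorff_dim E = s%:E -> 0 <= s.
Proof.
move=> dimE; rewrite -lee_fin -dimE; apply: le_ereal_inf_tmp => _ [u [u0 _] <-].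
by rewrite lee_fin.
Qed.

Lemma disjoint_wordsC w v : disjoint_words w v -> disjoint_words v w.
Proof. by move/asboolP => H; apply/asboolP => x y Kx Ky /esym; exact: H. Qed.

(** Each member of a disjoint family contributes at least the power [s] of [lo] to a sum bounded by
    1. Sizes are thus bounded, and a family of largest size admits no further word. *)
Lemma maximal_disjoint_words (s lo : R) (Q : seq 'I_m -> Prop) :
  hausdorff_dim K = s%:E -> 0 < lo ->
  (forall w, Q w -> lo <= word_ratio w < 1) ->
  exists X, [/\ forall w, w \in X -> Q w, pairwise disjoint_words X &
    forall w, Q w -> exists2 v, v \in X & ~~ disjoint_words v w].
Proof.
move=> dimK lo0 Qlo; have s0 := hausdorff_dim_ge0 _ _ dimK.
have los : 0 < lo `^ s by rewrite powR_gt0.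
pose good X := (forall w, w \in X -> Q w) /\ pairwise disjoint_words X.
pose P n : bool := `[< exists2 X, good X & size X = n >].
have P0 : exists n, P n.
  by exists 0; apply/asboolP; exists [::] => //; split.
have Pub n : P n -> (n <= Num.truncn (lo `^ s)^-1)%N.
  move=> /asboolP[X [XQ Xdis] <-];
  rewrite truncn_ge_nat; last by rewrite invr_ge0 ltW.
  rewrite -[leRHS]mul1r ler_pdivlMr//.
  have := powR_sum_disjoint_words_le1 _ _ dimK Xdis
    (fun w wX => proj2 (andP (Qlo w (XQ w wX)))).
  apply: le_trans; rewrite -sum1_size natr_sum mulr_suml.
  rewrite big_seq [leRHS]big_seq; apply: ler_sum => w /XQ/Qlo/andP[low _].
  by rewrite mul1r; apply: ge0_ler_powR; rewrite ?nnegrE ?(ltW lo0)// ltW// word_ratio_gt0.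
have [n /asboolP[X [XQ Xdis] Xn] nmax] := ex_maxnP P0 Pub.
exists X; split => // w Qw; apply: contrapT => no.
have /nmax : P n.+1; last by rewrite ltnn.
apply/asboolP; exists (w :: X); last by rewrite /= Xn.
split=> [v|]; first by rewrite inE => /predU1P[->//|]; exact: XQ.
rewrite /= Xdis andbT; apply/allP => v vX.
apply/negPn/negP => nwv; apply: no; exists v => //.
by apply: contra nwv; exact: disjoint_wordsC.
Qed.

(* At each scale, a maximal disjoint family of small copies meeting [E] covers
   [E] once the copies are enlarged, so the sum of its ratios to the power [s]
   is at least a constant times the content of [E].  The subcopies avoiding [E]
   inside the families obtained at a sparse sequence of scales are all disjoint,
   so those sums add up to at most a constant. *)
Lemma porous_hausdorff_content0 E (s c rho0 delta : R) :
  hausdorff_dim K = s%:E -> E `<=` K -> 0 < c -> 0 < rho0 -> 0 < delta ->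
  (forall w, word_ratio w <= rho0 -> (exists2 x, K x & E (word_map w x)) ->
    exists2 v, c <= word_ratio v & word_away E (w ++ v)) ->
  hausdorff_content s delta E = 0%E.
Proof.
move=> dimK EK c0 rho00 delta0 porous.
have s0 := hausdorff_dim_ge0 _ _ dimK.
apply/eqP; rewrite eq_le hausdorff_content_ge0 andbT leNgt; apply/negP => H0.
(* The content may be infinite, hence a finite positive [h] below it. *)
have [h h0 hH] : exists2 h : R, 0 < h & (h%:E <= hausdorff_content s delta E)%E.
  case: (hausdorff_content s delta E) H0 => [h|_|//]; last by exists 1; rewrite ?leey.
  by rewrite lte_fin => h0; exists h.
have [D D0 KD] := compact_edist_bounded K cK.
have [a /andP[a0 a1] scale] := word_at_scale.
(* The gain at each scale: the second factor bounds the sum over the maximal family from below, and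
   the first is the cost of passing to subcopies. *)
pose c' := c `^ s * (h / (4 * D / a) `^ s).
have DA : 0 < (4 * D / a) `^ s by rewrite powR_gt0// divr_gt0// mulr_gt0.
have c'0 : 0 < c' by rewrite mulr_gt0 ?powR_gt0// divr_gt0.
have [k0 Kk0] := K0.
suff family n : exists W, [/\ pairwise disjoint_words W,
    forall w, w \in W -> word_ratio w < 1 /\ word_away E w &
    n%:R * c' <= \sum_(w <- W) word_ratio w `^ s].
  have [W [Wdis W1]] := family (Num.truncn c'^-1).+1.
  rewrite leNgt => /negP; apply.
  apply: (le_lt_trans (powR_sum_disjoint_words_le1 _ _ dimK Wdis _)).
    by move=> w /W1[].
  by rewrite -ltr_pdivrMr// div1r truncnS_gt.
elim: n => [|n [W [Wdis W1 Wsum]]].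
  by exists [::]; rewrite mul0r big_nil; split.
have [e e0 We] : exists2 e : R, 0 < e & forall w, w \in W ->
    forall x y, K x -> E y -> e <= edist (word_map w x) y.
  have [e e0 He] : exists2 e : R, 0 < e & forall i : 'I_(size W),
      forall x y, K x -> E y -> e <= edist (word_map (tnth (in_tuple W) i) x) y.
    apply: finite_pos_lbound => [i e e' /andP[_ ee'] He x y Kx Ey|i].
      by rewrite (le_trans ee')// He.
    by have [] := W1 _ (mem_tnth i (in_tuple W)).
  by exists e => // w /(tnthP (in_tuple W))[i ->]; exact: He.
(* The four conditions keep ratios below 1, make the enlarged copies admissible for [delta], allow
   porosity to be applied, and separate the new copies from the old ones. *)
have [rho [rho1 rhoD rho_rho0 rhoe]] : exists rho, [/\ 0 < rho < 1,
    rho * (4 * D) <= delta, rho <= rho0 & rho * D < e].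
  have x0 : 0 < delta / (4 * D) by rewrite divr_gt0// mulr_gt0.
  have y0 : 0 < e / D by rewrite divr_gt0.
  exists (Num.min (Num.min 2^-1 (delta / (4 * D))) (Num.min rho0 (e / D / 2))).
  split.
  - by rewrite !lt_min !gt_min; apply/andP; split; [lra|apply/orP; left; apply/orP; left; lra].
  - by rewrite -ler_pdivlMr ?mulr_gt0// !ge_min lexx orbT.
  - by rewrite !ge_min lexx orbT.
  - rewrite -ltr_pdivlMr// !gt_min; apply/orP; right; apply/orP; right; lra.
have /andP[rho0' rho1'] := rho1.
pose Q w := a * rho <= word_ratio w <= rho /\ exists2 x, K x & E (word_map w x).
have [||X [XQ Xdis Xmax]] := maximal_disjoint_words s (a * rho) Q dimK.
- by rewrite mulr_gt0.
- by move=> w [/andP[-> wr] _]; rewrite (le_lt_trans wr).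
have Xsum : h / (4 * D / a) `^ s <= \sum_(w <- X) word_ratio w `^ s.
  rewrite ler_pdivrMr// -lee_fin (le_trans hH)// mulr_suml -sumEFin.
  (* A copy of ratio at most [rho] meeting that of [w] lies in [F w]: each of the two copies
     accounts for [rho * D]. *)
  pose F w := [set y | edist y (word_map w k0) <= 2 * (rho * D)].
  have Fd w x y : F w x -> F w y -> edist x y <= rho * (4 * D).
    rewrite /F /= => Fx Fy; have := edist_triangle (word_map w k0) x y.
    rewrite (edistC (word_map w k0)); lra.
  have rD : 0 <= rho * (4 * D) by rewrite !mulr_ge0 ?ltW.
  apply: (le_trans (hausdorff_content_finite_cover _ s delta E X F _ _)).
  - move=> y Ey.
    have [|w' [w'r [x' Kx' x'y]]] := scale rho y _ (EK _ Ey).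
      by rewrite rho0' ltW.
    have [|w wX] := Xmax w'; first by split => //; exists x' => //; rewrite x'y.
    move=> /asboolPn nd.
    have {nd}[z [z' [Kz Kz' zz']]] : exists z z', [/\ K z, K z' &
        word_map w z = word_map w' z'].
      apply: contrapT => no; apply: nd => z z' Kz Kz' zz'; apply: no.
      by exists z, z'.
    exists (index w X); first by rewrite index_mem.
    move=> w0; rewrite nth_index// /F /= -x'y.
    have := edist_triangle (word_map w' z') (word_map w' x') (word_map w k0).
    rewrite -{2}zz' !edist_word_map.
    have [/andP[_ wr] _] := XQ _ wX; have /andP[_ w'r'] := w'r.
    have : word_ratio w' * edist x' z' <= rho * D.
      by rewrite ler_pM ?edist_ge0 ?KD// ltW// word_ratio_gt0.
    have : word_ratio w * edist z k0 <= rho * D.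
      by rewrite ler_pM ?edist_ge0 ?KD// ltW// word_ratio_gt0.
    lra.
  - move=> w; apply: diam_le => x y Fx Fy.
    exact: le_trans (Fd _ _ _ Fx Fy) rhoD.
  - rewrite big_seq [leRHS]big_seq; apply: lee_sum => w /XQ[/andP[wr _] _].
    apply: (le_trans (diam_pow_le _ _ _ s0 rD (Fd w))).
    have w0 := word_ratio_gt0 w.
    rewrite lee_fin -powRM ?(ltW w0)//; last by rewrite divr_ge0 ?mulr_ge0 ?ltW.
    apply: ge0_ler_powR; rewrite ?nnegrE//.
      by rewrite mulr_ge0 ?(ltW w0)// divr_ge0 ?mulr_ge0 ?ltW.
    (* Words in [X] have ratio at least [a * rho], so [rho] is at most [word_ratio w / a]. *)
    rewrite [leRHS](_ : _ = word_ratio w / a * (4 * D)); last by ring.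
    by rewrite ler_wpM2r ?mulr_ge0 ?(ltW D0)// ler_pdivlMr// mulrC.
have [v vP] : {v : seq 'I_m -> seq 'I_m & forall w, w \in X ->
    c <= word_ratio (v w) /\ word_away E (w ++ v w)}.
  apply: (@choice _ _ (fun w v => w \in X ->
    c <= word_ratio v /\ word_away E (w ++ v))) => w.
  have [wX|] := boolP (w \in X); last by exists [::].
  have [/andP[_ wr] wE] := XQ _ wX.
  by have [|v cv vE] := porous w _ wE; [exact: le_trans rho_rho0|exists v].
exists (W ++ [seq w ++ v w | w <- X]); split.
- rewrite pairwise_cat Wdis /= pairwise_map; apply/andP; split.
    (* A new copy lies within [rho * D < e] of a point of [E], while an old one keeps distance [e]
       from [E]. *)
    apply/allrelP => w _ wW /mapP[u uX ->]; apply/asboolP => x y Kx Ky wu.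
    have [/andP[_ ur] [z Kz Ez]] := XQ _ uX.
    have := We _ wW _ _ Kx Ez; rewrite wu word_map_cat edist_word_map.
    have : word_ratio u * edist (word_map (v u) y) z <= rho * D.
      by rewrite ler_pM ?edist_ge0 ?KD//; [rewrite ltW// word_ratio_gt0|exact: word_map_in].
    lra.
  apply: sub_pairwise Xdis => w u /asboolP wu; apply/asboolP => x y Kx Ky /=.
  by rewrite !word_map_cat; apply: wu; exact: word_map_in.
- move=> w; rewrite mem_cat => /orP[/W1//|/mapP[u uX ->]].
  have [/andP[_ ur] _] := XQ _ uX; have [_ uE] := vP _ uX; split => //.
  rewrite word_ratio_cat.
  have := word_ratio_le1 (v u); have := word_ratio_gt0 u; nra.
- rewrite -[n.+1]addn1 natrD mulrDl mul1r big_cat big_map lerD//=.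
  apply: (le_trans (ler_wpM2l (powR_ge0 c s) Xsum)).
  rewrite mulr_sumr big_seq [leRHS]big_seq; apply: ler_sum => w wX.
  have [cv _] := vP _ wX.
  rewrite word_ratio_cat powRM ?(ltW (word_ratio_gt0 _))// mulrC.
  rewrite ler_wpM2l ?powR_ge0//; apply: ge0_ler_powR; rewrite ?nnegrE ?(ltW c0)//.
  by rewrite ltW// word_ratio_gt0.
Qed.

Lemma word_away_subset E E' w : E' `<=` E -> word_away E w -> word_away E' w.
Proof. by move=> EE' [e e0 He]; exists e => // x y Kx /EE'; exact: He. Qed.

(* If every subcopy of the copy indexed by [w] came close to [G], then [G] would
   contain points [q i] close to the images of [l + 2] affinely independent
   points of [K]; but near [x] the set [G] is flat. *)
Lemma submanifold_porous (G : set 'rV[R]_d) l : C1_submanifold l G ->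
  ~ (exists M : set 'rV[R]_d, affine_subspace l M /\ K `<=` M) ->
  exists2 c : R, 0 < c & forall x, K x -> G x -> exists2 rho0 : R, 0 < rho0 &
  forall w, word_ratio w <= rho0 -> (word_map w @` K) x ->
    exists2 v, c <= word_ratio v & word_away (K `&` G) (w ++ v).
Proof.
move=> manG noM; have [ld _] := manG.
have [p0 Kp0] := K0.
have [p [fp Kp]] := affinely_free_points _ _ _ ld Kp0 noM.
have [kappa kappa0 Hkappa] := free_lincomb_lbound _ _ fp.
have [D D0 KD] := compact_edist_bounded K cK.
have [a /andP[a0 a1] scale] := word_at_scale.
pose n : R := l.+1%:R; have n0 : 0 < n by rewrite ltr0n.
(* Approximating the points will cost [kappa * rho / 2] and, by the choice of [eta], non-flatness
   [kappa * rho / 4]; together less than the lower bound [kappa * rho]. *)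
pose eps := kappa / (8 * n).
have eps0 : 0 < eps by rewrite divr_gt0// mulr_gt0.
pose rho1 := Num.min 1 (eps / D).
have rho10 : 0 < rho1 by rewrite lt_min ltr01 divr_gt0.
have rho1D : rho1 * D <= eps by rewrite -ler_pdivlMr// ge_min lexx orbT.
exists (a * rho1) => [|x Kx Gx]; first by rewrite mulr_gt0.
have [A [X [AX tangent]]] := C1_submanifold_tangent _ _ _ manG Gx.
have [C C0 flat] := flat_lincomb _ _ _ ld AX.
(* [D' * rho] bounds the distance to [x] from points within [2 * eps * rho] of the copy of [w]. *)
pose D' := 2 * eps + D; have D'0 : 0 < D' by rewrite addr_gt0// mulr_gt0.
pose eta := kappa / (8 * C * D').
have eta0 : 0 < eta by rewrite divr_gt0// !mulr_gt0.
have [theta theta0 Htheta] := tangent eta eta0.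
exists (theta / (2 * D')) => [|w]; first by rewrite divr_gt0// mulr_gt0.
have := word_ratio_gt0 w; set rho := word_ratio w => rho0.
rewrite ler_pdivlMr ?mulr_gt0// => rhotheta [x' Kx' x'x].
apply: contrapT => noaway.
have near y : K y -> exists2 q, (K `&` G) q & edist q (word_map w y) <= 2 * eps * rho.
  move=> Ky; have [|v [/andP[av vrho] [z Kz zy]]] := scale rho1 y _ Ky.
    by rewrite rho10 ge_min lexx.
  (* The subcopy of [v] has diameter at most [eps * rho] and contains the image of [y]; with no such
     [q] it would keep distance [eps * rho] from the intersection. *)
  apply: contrapT => noq; apply: noaway; exists v => //.
  exists (eps * rho) => [|k q Kk Eq]; first by rewrite mulr_gt0.
  rewrite leNgt; apply/negP => kq; apply: noq; exists q => //.
  have := edist_triangle (word_map (w ++ v) k) q (word_map w y).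
  have -> : edist (word_map (w ++ v) k) (word_map w y) =
      rho * (word_ratio v * edist k z).
    by rewrite word_map_cat -zy !edist_word_map.
  have : rho * (word_ratio v * edist k z) <= rho * eps.
    rewrite ler_wpM2l ?(ltW rho0)// (le_trans _ rho1D)//.
    by rewrite ler_pM ?edist_ge0 ?KD// ltW ?word_ratio_gt0.
  rewrite (edistC q (word_map (w ++ v) k)); lra.
have [q0 [_ Gq0] q0p] := near _ Kp0.
have [q qP] : {q : 'I_l.+1 -> 'rV[R]_d & forall i, G (q i) /\
    edist (q i) (word_map w (p`_i + p0)) <= 2 * eps * rho}.
  apply: (@choice _ _ (fun (i : 'I_l.+1) q => G q /\
    edist q (word_map w (p`_i + p0)) <= 2 * eps * rho)) => i.
  by have [q [_ Gq] qp] := near _ (Kp i); exists q.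
have close y z : K y -> edist z (word_map w y) <= 2 * eps * rho ->
    `|z - x| <= D' * rho.
  move=> Ky zy; rewrite (le_trans (norm_le_enorm _))// -edistE.
  have := edist_triangle (word_map w y) z x.
  rewrite -{2}x'x edist_word_map -/rho.
  have : rho * edist y x' <= rho * D by rewrite ler_wpM2l ?KD// ltW.
  rewrite /D'; lra.
have D'theta : D' * rho < theta.
  by move: rhotheta (mulr_gt0 D'0 rho0); lra.
have colsmall z (j : 'I_d) : G z -> `|z - x| <= D' * rho -> (l <= j)%N ->
    `|((z - x) *m A) 0 j| <= eta * (D' * rho).
  move=> Gz zx lj; apply: le_trans (Htheta _ _ Gz (le_lt_trans zx D'theta) lj) _.
  by rewrite ler_wpM2l// ltW.
have [||c [c1 [i0 ci0] csmall]] := flat (fun i => q i - q0) (2 * (eta * (D' * rho))).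
- by apply: mulr_ge0 => //; apply: mulr_ge0; [|apply: mulr_ge0]; exact: ltW.
- move=> i j lj; have [Gq qp] := qP i.
  rewrite -[q i - q0](subrKA x) -[x - q0]opprB mulmxBl !mxE.
  rewrite (le_trans (ler_normB _ _))//.
  have := colsmall _ _ Gq (close _ _ (Kp i) qp) lj.
  have := colsmall _ _ Gq0 (close _ _ Kp0 q0p) lj.
  rewrite !mxE; lra.
pose u i := word_map w (p`_i + p0) - word_map w p0.
have uE : enorm (\sum_i c i *: u i) = rho * enorm (\sum_i c i *: p`_i).
  apply: enorm_lincomb => [|i|i j]; first exact: ltW.
    by rewrite /u -edistE edist_word_map edistE addrK.
  have -> : u i - u j = word_map w (p`_i + p0) - word_map w (p`_j + p0).
    by rewrite /u opprB addrA subrK.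
  rewrite -edistE edist_word_map edistE.
  by rewrite opprD addrACA subrr addr0.
have ularge : rho * kappa <= enorm (\sum_i c i *: u i).
  by rewrite uE ler_wpM2l ?(ltW rho0)// -[kappa]mulr1 -ci0.
(* Each term has an error [2 * eps * rho] from [q i] and another from [q0]. *)
have udiff : enorm (\sum_i c i *: (u i - (q i - q0))) <= n * (4 * eps * rho).
  have -> : n * (4 * eps * rho) = \sum_(i < l.+1) 4 * eps * rho.
    by rewrite sumr_const card_ord -[RHS]mulr_natl.
  apply: le_trans (enorm_sum _ _) _; apply: ler_sum => i _; have [_ qp] := qP i.
  rewrite enormZ -[leRHS]mul1r ler_pM ?enorm_ge0//.
  have -> : u i - (q i - q0) =
      (q0 - word_map w p0) - (q i - word_map w (p`_i + p0)).
    by rewrite /u !opprB addrACA [RHS]addrACA [q0 + _]addrC.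
  rewrite (le_trans (enormD _ _))// enormN -!edistE; lra.
have : enorm (\sum_i c i *: u i) <=
    enorm (\sum_i c i *: (u i - (q i - q0))) + enorm (\sum_i c i *: (q i - q0)).
  rewrite (le_trans _ (enormD _ _))// -big_split /=.
  by under [X in _ <= enorm X]eq_bigr => i _ do rewrite -scalerDr subrK.
have e1 : n * (4 * eps * rho) = kappa * rho / 2.
  by rewrite /eps; field; rewrite gt_eqF.
have e2 : C * (2 * (eta * (D' * rho))) = kappa * rho / 4.
  by rewrite /eta; field; rewrite !gt_eqF.
have := mulr_gt0 kappa0 rho0; move: csmall udiff ularge; rewrite e1 e2.
rewrite [rho * kappa]mulrC.
lra.
Qed.

End porous_subsets.

(** * Decomposition of the intersection by scale of porosity *)

Theorem corollary2p3 (R : realType) (d : nat) (K : set 'rV[R]_d) (s : R) (l : nat) :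
  self_similar K ->
  hausdorff_dim K = s%:E ->
  s <= l%:R ->
  (exists M : set 'rV[R]_d, affine_subspace l M /\ K `<=` M) \/
  (forall Gamma : set 'rV[R]_d, C1_submanifold l Gamma ->
     hausdorff_measure s (K `&` Gamma) = 0%E).
Proof.
move=> [m [S [simS [K0 cK KS]]]] dimK _.
have [|noM] := pselect (exists M : set 'rV[R]_d, affine_subspace l M /\ K `<=` M).
  by left.
right=> G manG; have [r rP] := choice simS.
have r01 i : 0 < r i < 1 by have [] := rP i.
have rS i x y : edist (S i x) (S i y) = r i * edist x y.
  by have [_ +] := rP i; apply.
have [c c0 porous] := submanifold_porous S r K r01 rS K0 cK KS _ _ manG noM.
(* The threshold [rho0] depends on the point; on [E n] it can be taken to be [1 / (n + 1)], and
   these sets exhaust the intersection. *)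
pose E n := [set x | (K `&` G) x /\ forall w, word_ratio r w <= n.+1%:R^-1 ->
  (word_map S w @` K) x ->
  exists2 v, c <= word_ratio r v & word_away S K (K `&` G) (w ++ v)].
have -> : K `&` G = \bigcup_n E n.
  apply/seteqP; split=> [x [Kx Gx]|x [n _ []//]].
  have [rho0 rho00 Hrho0] := porous x Kx Gx.
  exists (Num.truncn rho0^-1) => //; split=> // w wr; apply: Hrho0.
  rewrite (le_trans wr)// -[leRHS]invrK lef_pV2 ?posrE ?invr_gt0//.
  by rewrite ltW// truncnS_gt.
apply: hausdorff_measure_bigcup0 => n; apply/hausdorff_measure_eq0 => delta delta0.
apply: (porous_hausdorff_content0 S r K r01 rS K0 cK KS (E n) s c n.+1%:R^-1) => //.
- by move=> x [[]].
- move=> w wr [x Kx [Ex Hx]]; have [|v cv vaway] := Hx w wr; first by exists x.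
  (* The subcopy stays away from the whole intersection, hence from [E n]. *)
  by exists v => //; apply: word_away_subset vaway => y [].
Qed.
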